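(* There exists a tight $11$-point simplex in $G(2,5)$. In fact, there is such a tight simplex with cyclic symmetry, i.e., one mapped to itself by the isometry of $G(2,5)$ induced by the cyclic coordinate shift $\sigma(x_1,\dots,x_5)=(x_2,\dots,x_5,x_1)$ of $\mathbb{R}^5$.
   Context: $G(m,n)$ is the space of $m$-dimensional linear subspaces of $\mathbb{R}^n$, each identified with its orthogonal projection matrix. A tight $N$-point simplex in $G(m,n)$ is a set of $N$ distinct subspaces with projection matrices $\Pi_1,\dots,\Pi_N$ such that $\operatorname{tr}(\Pi_i\Pi_j)=\frac{m(Nm-n)}{n(N-1)}$ for all $i\ne j$. *)

(* Defs.v *)
From HB Require Import structures.
From mathcomp Require Import all_boot all_order all_algebra.
From mathcomp Require Import reals.
Set Implicit Arguments. Unset Strict Implicit. Unset Printing Implicit Defensive.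
Import Order.TTheory GRing.Theory Num.Theory.
Local Open Scope ring_scope.

(* An m-dimensional subspace of R^n is identified with its orthogonal
   projection matrix: symmetric, idempotent, of rank m. *)
Definition is_grass_point (R : realType) (m n : nat) (P : 'M[R]_n) : Prop :=
  P^T = P /\ P *m P = P /\ \rank P = m.

Definition tight_simplex (R : realType) (m n N : nat) (Pi : 'I_N -> 'M[R]_n)
  : Prop :=
  injective Pi /\
  (forall i, is_grass_point m (Pi i)) /\
  (forall i j, i != j ->
     \tr (Pi i *m Pi j) =
       (m%:R * (N%:R * m%:R - n%:R)) / (n%:R * (N%:R - 1))).

Definition shift_mx (R : realType) (n : nat) : 'M[R]_n :=
  \matrix_(i, j) ((nat_of_ord j == (i.+1 %% n)%N)%:R).

(* The isometry of G(m,n) induced by sigma maps the subspace V to sigma(V),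
   i.e. the projection P to S P S^T. *)
Definition shift_act (R : realType) (n : nat) (P : 'M[R]_n) : 'M[R]_n :=
  shift_mx R n *m P *m (shift_mx R n)^T.

(* Main.v *)
(* With z = sqrt 5, let F be the plane of frequency 1 of the cyclic shift, and
   let A, B be two planes, so that the 11 points are F and the shifts of A and B.
   Since the traces sum up to expressions in the circulant sums
   circ P d = \sum_i P i (i + d), it is enough to prescribe the circulant sums
   of A + B, the product tr (A F), and seven of the products between A, B and
   their shifts; the remaining products are then determined.  Rotating a basis
   inside A and inside B, and using the 2-torus of isometries that commute with
   the shift, four of the 20 coordinates of the bases of A and B may be taken to
   be 0, which leaves 17 polynomial equations in 17 unknowns (z included).

   A nondegenerate real solution exists near an explicit rational point: after
   preconditioning by an approximate inverse of the Jacobian matrix, the Newton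
   map is a contraction of a small cube.  The contraction property is checked by
   an exact integer computation on first-order jets with an error bound. *)
Require Import Defs.
From HB Require Import structures.
From Stdlib Require Import ZArith.
From mathcomp Require Import all_boot all_order all_algebra.
From mathcomp Require Import all_classical interval_inference reals topology.
From mathcomp Require Import normedtype sequences.
From mathcomp Require Import zify ssrZ ring lra.
Set Implicit Arguments. Unset Strict Implicit. Unset Printing Implicit Defensive.
Import Order.TTheory GRing.Theory Num.Theory.
Import numFieldNormedType.Exports.
Local Open Scope ring_scope.
(* MathComp rebinds %Z to its own integers [int]. *)
Delimit Scope Z_scope with Z.

(** * Systems of equations solved by a contraction *)

(** Banach's fixed point theorem needs row vectors with the sup norm as a complete normed space. *)
HB.instance Definition _ (R : realType) (n : nat) :=
  Uniform_isComplete.Build 'rV[R]_n (@cauchy_cvg _).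

Lemma rV_norm_le (R : realType) n (y : 'rV[R]_n) (b : R) :
  0 <= b -> (forall j, `|y 0 j| <= b) -> `|y| <= b.
Proof.
move=> b0 yb; rewrite [leLHS]/Num.Def.normr/= mx_normrE (bigmax_le _ b0)//=.
by move=> [i j] _ /=; rewrite ord1.
Qed.

Lemma rV_coord_le (R : realType) n (y : 'rV[R]_n) j : `|y 0 j| <= `|y|.
Proof.
rewrite [leRHS]/Num.Def.normr/= mx_normrE.
exact: (le_bigmax _ (fun ij : 'I_1 * 'I_n => `|y ij.1 ij.2|) (0, j)).
Qed.

(* [y] is a fixed point of [y |-> - G y / D], which contracts by 1/2. *)
Lemma half_contraction_solution (R : realType) n (D : 'I_n -> R) (rho : R)
    (G : 'I_n -> 'rV[R]_n -> R) :
  0 <= rho -> (forall k, 0 < D k) ->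
  (forall k, 2 * `|G k 0| <= D k * rho) ->
  (forall k y y', `|y| <= rho -> `|y'| <= rho ->
     2 * `|G k y - G k y'| <= D k * `|y - y'|) ->
  exists y : 'rV[R]_n, forall k, G k y + D k * y 0 k = 0.
Proof.
move=> rho0 D0 G0 GL.
pose h (y : 'rV[R]_n) := \row_k (- G k y / D k) : 'rV[R]_n.
have hL y y' : `|y| <= rho -> `|y'| <= rho -> `|h y - h y'| <= 2^-1 * `|y - y'|.
  move=> yr yr'; apply: rV_norm_le => [|k]; first by rewrite mulr_ge0 ?invr_ge0.
  rewrite !mxE -mulrBl normrM normfV (gtr0_norm (D0 k)) ler_pdivrMr//.
  rewrite -opprD normrN; have := GL k _ _ yr yr'.
  by set t := `|y - y'|; set g := `|_ - _|; lra.
have h0 : `|h 0| <= 2^-1 * rho.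
  apply: rV_norm_le => [|k]; first by rewrite mulr_ge0 ?invr_ge0.
  rewrite !mxE normrM normfV (gtr0_norm (D0 k)) ler_pdivrMr// normrN.
  by have := G0 k; lra.
pose U : set 'rV[R]_n := [set y | `|y| <= rho]%classic.
(* The ball is mapped to itself: [h y - h 0] and [h 0] each have norm at most [rho / 2]. *)
have hU : set_fun U U h.
  move=> y /= yr; rewrite /U /= -[h y](subrK (h 0)).
  have n0 : `|0 : 'rV[R]_n| <= rho by rewrite normr0.
  have := hL _ _ yr n0; rewrite subr0 => hy.
  apply: (le_trans (ler_normD _ _)); apply: (le_trans (lerD hy h0)).
  have : `|y| <= rho by [].
  by set t := `|y|; lra.
pose f : {fun U >-> U} := mkfun hU.
have [|||p Up pE] := @banach_fixed_point R ('rV[R]_n : completeNormedModType R) U f.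
- exists (2^-1)%:nng; split=> /=; first by rewrite invf_lt1 ?ltr1n.
  by move=> [y y'] /= [yr yr']; exact: hL.
- have -> : U = closed_ball_ Num.norm (0 : 'rV[R]_n) rho.
    by apply/seteqP; split=> y; rewrite /U /closed_ball_ /= sub0r normrN.
  exact: closed_closed_ball_.
- by exists 0; rewrite /U /= normr0.
- exists p => k.
  have -> : p 0 k = - G k p / D k by rewrite {1}pE /= mxE.
  by rewrite mulrC divfK ?gt_eqF// subrr.
Qed.

(** * Integer data and linear forms with integer coefficients *)

Definition Zr (R : pzRingType) (z : Z) : R := (int_of_Z z)%:~R.

Section Zr.
Variable R : realType.

Lemma Zr0 : Zr R 0 = 0. Proof. by []. Qed.
Lemma ZrD x y : Zr R (x + y) = Zr R x + Zr R y.
Proof. by rewrite /Zr rmorphD rmorphD. Qed.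
Lemma ZrN x : Zr R (- x) = - Zr R x.
Proof. by rewrite /Zr rmorphN rmorphN. Qed.
Lemma ZrM x y : Zr R (x * y) = Zr R x * Zr R y.
Proof. by rewrite /Zr rmorphM rmorphM. Qed.
Lemma ZrMn x k : Zr R (x *+ k) = Zr R x *+ k.
Proof. by rewrite /Zr rmorphMn rmorphMn. Qed.
Lemma Zr_le x y : (Zr R x <= Zr R y) = (x <= y).
Proof. by rewrite /Zr ler_int; lia. Qed.
Lemma Zr_lt x y : (Zr R x < Zr R y) = (x < y).
Proof. by rewrite !ltNge Zr_le. Qed.
Lemma Zr_norm x : Zr R `|x| = `|Zr R x|.
Proof. by rewrite /Zr -intr_norm; congr _%:~R; lia. Qed.

End Zr.

(** Coefficient lists stand for vectors padded by zeros, so a constant can have the empty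
    gradient. *)
Fixpoint addl (a b : seq Z) : seq Z :=
  match a, b with
  | [::], _ => b
  | _, [::] => a
  | x :: a', y :: b' => x + y :: addl a' b'
  end.

Definition l1 (a : seq Z) : Z := foldr (fun x s => `|x| + s) 0 a.

Definition dot (R : realType) n (a : seq Z) (y : 'rV[R]_n) : R :=
  \sum_(j < n) Zr R a`_j * y 0 j.

Section Dot.
Variables (R : realType) (n : nat).
Implicit Types (a b : seq Z) (y : 'rV[R]_n).

Lemma nth_addl a b j : (addl a b)`_j = a`_j + b`_j.
Proof.
by elim: a b j => [|x a IH] [|y b] [|j] //=; rewrite ?add0r ?addr0 ?nth_nil ?add0r ?addr0.
Qed.

Lemma dotD a b y : dot (addl a b) y = dot a y + dot b y.
Proof.
by rewrite -big_split; apply: eq_bigr => j _; rewrite nth_addl ZrD mulrDl.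
Qed.

Lemma dotZ c a y : dot [seq c * x | x <- a] y = Zr R c * dot a y.
Proof.
rewrite mulr_sumr; apply: eq_bigr => j _; rewrite mulrA -ZrM.
have [ja|ja] := ltnP j (size a); first by rewrite (nth_map 0).
rewrite !nth_default ?size_map//. congr (Zr R _ * _); exact/esym/mulr0.
Qed.

Lemma dot_nil y : dot [::] y = 0.
Proof. by apply: big1 => j _; rewrite nth_nil mul0r. Qed.

Lemma dotB a y y' : dot a (y - y') = dot a y - dot a y'.
Proof. by rewrite -sumrB; apply: eq_bigr => j _; rewrite !mxE mulrBr. Qed.

Lemma dot0 a : dot a (0 : 'rV[R]_n) = 0.
Proof. by apply: big1 => j _; rewrite mxE mulr0. Qed.

Lemma dot_unit (k : 'I_n) c y : dot (rcons (nseq k 0) c) y = Zr R c * y 0 k.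
Proof.
rewrite /dot (bigD1 k)//= big1 ?addr0 => [|j jk].
  by rewrite nth_rcons size_nseq ltnn eqxx.
rewrite nth_rcons size_nseq nth_nseq; case: ltnP => // kj; rewrite ?mul0r//.
by rewrite (negbTE (jk : j != k :> nat)) mul0r.
Qed.

Lemma l1_ge0 a : 0 <= l1 a.
Proof. by elim: a => //= x a IH; rewrite addr_ge0. Qed.

Lemma sum_le_l1 a : \sum_(j < n) `|Zr R a`_j| <= Zr R (l1 a).
Proof.
elim: a n => [|x a IH] [|m]; rewrite ?big_ord0 ?big_ord_recl.
- by rewrite Zr0.
- by rewrite big1 ?nth_nil ?Zr0 ?normr0 ?addr0// => i _; rewrite nth_nil normr0.
- by rewrite -[0](Zr0 R) Zr_le l1_ge0.
- by rewrite ZrD Zr_norm lerD2l; exact: IH.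
Qed.

Lemma dot_le a y : `|dot a y| <= Zr R (l1 a) * `|y|.
Proof.
apply: (le_trans (ler_norm_sum _ _ _)).
apply: le_trans (ler_wpM2r (normr_ge0 y) (sum_le_l1 a)).
rewrite mulr_suml; apply: ler_sum => j _.
by rewrite normrM ler_wpM2l// rV_coord_le.
Qed.

End Dot.

(** * Polynomial expressions and first-order jets with error bounds *)

Inductive pexp := Cst of Z | Var of nat | Add of pexp & pexp | Mul of pexp & pexp.

Fixpoint peval (R : pzRingType) (x : nat -> R) (p : pexp) : R :=
  match p with
  | Cst z => Zr R z
  | Var i => x i
  | Add p q => peval x p + peval x q
  | Mul p q => peval x p * peval x q
  end.

Record jet := Jet { jval : Z; jgrad : seq Z; jerr : Z }.

(** Lipschitz bound on the cube for the whole function, linear part plus remainder. *)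
Definition jlip (J : jet) : Z := l1 (jgrad J) + jerr J.

Definition jadd (J K : jet) : jet :=
  Jet (jval J + jval K) (addl (jgrad J) (jgrad K)) (jerr J + jerr K).

(** Product rule; in the last two error terms [rho * jlip] bounds how far one factor strays from its
    value at 0 on the cube. *)
Definition jmul (rho : Z) (J K : jet) : jet :=
  Jet (jval J * jval K)
      (addl [seq jval J * x | x <- jgrad K] [seq jval K * x | x <- jgrad J])
      (`|jval J| * jerr K + `|jval K| * jerr J
       + (rho * jlip J * jlip K + rho * jlip K * jlip J)).

Definition affine := (Z * seq Z)%type.

Fixpoint jet_of (rho : Z) (X : seq affine) (p : pexp) : jet :=
  match p with
  | Cst z => Jet z [::] 0
  | Var i => let a := nth (0, [::]) X i in Jet a.1 a.2 0
  | Add p q => jadd (jet_of rho X p) (jet_of rho X q)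
  | Mul p q => jmul rho (jet_of rho X p) (jet_of rho X q)
  end.

(* A jet records the value and the gradient of [f] at 0, and a bound on the
   Lipschitz constant of the remainder on the cube of radius [rho]. *)
Definition is_jet (R : realType) n (rho : Z) (f : 'rV[R]_n -> R) (J : jet) :=
  [/\ 0 <= jerr J, f 0 = Zr R (jval J) &
   forall y y', `|y| <= Zr R rho -> `|y'| <= Zr R rho ->
     `|f y - f y' - dot (jgrad J) (y - y')| <= Zr R (jerr J) * `|y - y'| ].

Section Jets.
Variables (R : realType) (n : nat) (rho : Z).
Hypothesis rho0 : 0 <= rho.
Implicit Types (f g : 'rV[R]_n -> R) (J K : jet).

Lemma jlip_ge0 f J : is_jet rho f J -> 0 <= jlip J.
Proof. by case=> e0 _ _; rewrite addr_ge0// l1_ge0. Qed.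

Lemma is_jet_lip f J : is_jet rho f J -> forall y y',
  `|y| <= Zr R rho -> `|y'| <= Zr R rho ->
  `|f y - f y'| <= Zr R (jlip J) * `|y - y'|.
Proof.
case=> _ _ fJ y y' yr yr'; rewrite -[f y - f y'](subrK (dot (jgrad J) (y - y'))).
apply: (le_trans (ler_normD _ _)); rewrite ZrD mulrDl addrC.
exact: lerD (dot_le _ _) (fJ _ _ yr yr').
Qed.

Lemma is_jet_dev f J : is_jet rho f J -> forall y, `|y| <= Zr R rho ->
  `|f y - Zr R (jval J)| <= Zr R (rho * jlip J).
Proof.
move=> fJ y yr; have [_ <- _] := fJ.
have n0 : `|0 : 'rV[R]_n| <= Zr R rho by rewrite normr0 -(Zr0 R) Zr_le.
apply: (le_trans (is_jet_lip fJ yr n0)); rewrite subr0 mulrC ZrM.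
by rewrite ler_wpM2r// -(Zr0 R) Zr_le; exact: jlip_ge0 fJ.
Qed.

Lemma is_jet_affine z a : is_jet rho (fun y : 'rV[R]_n => Zr R z + dot a y) (Jet z a 0).
Proof.
split=> //= [|y y' _ _]; first by rewrite dot0 addr0.
by rewrite dotB opprD addrACA subrr add0r subrr normr0 mul0r.
Qed.

Lemma is_jetD f g J K : is_jet rho f J -> is_jet rho g K ->
  is_jet rho (fun y => f y + g y) (jadd J K).
Proof.
move=> [eJ f0 fJ] [eK g0 gK]; split=> /= [||y y' yr yr'].
- by rewrite addr_ge0.
- by rewrite f0 g0 ZrD.
- rewrite dotD ZrD mulrDl.
  apply: le_trans (lerD (fJ _ _ yr yr') (gK _ _ yr yr')).
  apply: le_trans (ler_normD _ _); rewrite le_eqVlt; apply/orP; left.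
  by apply/eqP; congr `|_|; ring.
Qed.

Lemma is_jetM f g J K : is_jet rho f J -> is_jet rho g K ->
  is_jet rho (fun y => f y * g y) (jmul rho J K).
Proof.
move=> fJ gK; have [eJ f0 fE] := fJ; have [eK g0 gE] := gK.
have LJ := jlip_ge0 fJ; have LK := jlip_ge0 gK.
split=> /= [||y y' yr yr'].
- by rewrite !addr_ge0 ?mulr_ge0.
- by rewrite f0 g0 ZrM.
- rewrite dotD !dotZ; set d := y - y'; set c := Zr R (jval J); set c' := Zr R (jval K).
  (* Write the increment as f(y)(g(y) - g(y')) + g(y')(f(y) - f(y')), then split f(y) and g(y') into
     value at 0 plus deviation. *)
  have -> : f y * g y - f y' * g y'
        - (c * dot (jgrad K) d + c' * dot (jgrad J) d) =
      (c * (g y - g y' - dot (jgrad K) d) + c' * (f y - f y' - dot (jgrad J) d))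
      + ((f y - c) * (g y - g y') + (g y' - c') * (f y - f y')) by ring.
  rewrite !ZrD [leRHS]mulrDl.
  apply: (le_trans (ler_normD _ _)); apply: lerD; rewrite [leRHS]mulrDl;
    apply: (le_trans (ler_normD _ _)); apply: lerD; rewrite normrM.
  + by rewrite ZrM Zr_norm -mulrA ler_wpM2l// gE.
  + by rewrite ZrM Zr_norm -mulrA ler_wpM2l// fE.
  + by rewrite ZrM -mulrA ler_pM// ?(is_jet_dev fJ)// (is_jet_lip gK).
  + by rewrite ZrM -mulrA ler_pM// ?(is_jet_dev gK)// (is_jet_lip fJ).
Qed.

Definition point (X : seq affine) (y : 'rV[R]_n) (i : nat) : R :=
  let a := nth (0, [::]) X i in Zr R a.1 + dot a.2 y.

Lemma jet_ofP X p : is_jet rho (fun y => peval (point X y) p) (jet_of rho X p).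
Proof.
elim: p => [z|i|p IHp q IHq|p IHp q IHq] /=.
- have := is_jet_affine z [::]; congr is_jet.
  by apply/funext => y; rewrite dot_nil addr0.
- exact: is_jet_affine.
- exact: is_jetD.
- exact: is_jetM.
Qed.

End Jets.

(* The integer paired with the k-th equation is the approximate derivative of
   this equation along the k-th parameter of the chart [X]. *)
Definition newton_check (rho : Z) (X : seq affine) (eqs : seq (Z * pexp)) : bool :=
  (0 <= rho) &&
  all (fun k => let e := nth (0, Cst 0) eqs k in
    let J := jadd (jet_of rho X e.2) (Jet 0 (rcons (nseq k 0) (- e.1)) 0) in
    [&& 0 < e.1, jval J *+ 2 <= e.1 * rho, - (jval J *+ 2) <= e.1 * rho
      & jlip J *+ 2 <= e.1])
    (iota 0 (size eqs)).

Lemma newton_root (R : realType) rho X eqs : newton_check rho X eqs ->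
  exists x : nat -> R, forall k, (k < size eqs)%N ->
    peval x (nth (0, Cst 0) eqs k).2 = 0.
Proof.
case/andP=> rho0 /allP chk; pose n := size eqs.
pose e (k : nat) := nth (0, Cst 0) eqs k.
pose J (k : nat) := jadd (jet_of rho X (e k).2) (Jet 0 (rcons (nseq k 0) (- (e k).1)) 0).
(* Removing the expected linear term from the k-th equation leaves a nearly constant [G k]; the
   check bounds its value at 0 and its Lipschitz constant. *)
pose G (k : 'I_n) (y : 'rV[R]_n) := peval (point X y) (e k).2 - Zr R (e k).1 * y 0 k.
have GJ k : is_jet rho (G k) (J k).
  have := is_jetD (jet_ofP R n rho0 X (e k).2)
    (is_jet_affine R n rho 0 (rcons (nseq k 0) (- (e k).1))).
  congr is_jet; apply/funext => y.
  by rewrite Zr0 add0r dot_unit ZrN mulNr.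
have chkk (k : 'I_n) : [/\ 0 < (e k).1, jval (J k) *+ 2 <= (e k).1 * rho,
    - (jval (J k) *+ 2) <= (e k).1 * rho & jlip (J k) *+ 2 <= (e k).1].
  by apply/and4P; apply: chk; rewrite mem_iota add0n ltn_ord.
have [||k|k y y' yr yr'|y Gy] :=
    @half_contraction_solution R n (fun k => Zr R (e k).1) (Zr R rho) G.
- by rewrite -(Zr0 R) Zr_le.
- by move=> k; have [? _ _ _] := chkk k; rewrite -(Zr0 R) Zr_lt.
- have [_ -> _] := GJ k; have [_ c1 c2 _] := chkk k.
  rewrite mulr_natl -normrMn -ZrMn -ZrM ler_norml lerNl -ZrN !Zr_le.
  by rewrite c1 c2.
- apply: (le_trans (ler_wpM2l _ (is_jet_lip (GJ k) yr yr'))) => //.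
  rewrite mulrA ler_wpM2r// mulr_natl -ZrMn Zr_le.
  by have [] := chkk k.
- exists (point X y) => k kn.
  by rewrite -(Gy (Ordinal kn)) /G subrK.
Qed.

(** * Simplices made of two orbits of planes and one invariant plane *)

(** In a full-rank factorization P = CB, idempotency forces BC = 1, so tr P = tr BC is the rank. *)
Lemma mxrank_idempotent (F : fieldType) n (P : 'M[F]_n) :
  P *m P = P -> (\rank P)%:R = \tr P.
Proof.
move=> PP; move: (row_base_free P) (col_base_full P) (mulmx_base P).
move: (row_base P) (col_base P) => B C freeB fullC CB.
have BC : B *m C = 1%:M.
  apply: (row_free_inj freeB); apply: (row_full_inj fullC).
  by rewrite mul1mx !mulmxA CB -mulmxA CB.
by rewrite -[in RHS]CB mxtrace_mulC BC mxtrace1.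
Qed.

(** * Cyclic shifts of matrices and circulant sums *)

Section CyclicShift.
Variables (R : realType) (n : nat).
Implicit Types (P Q : 'M[R]_n.+1) (d k : 'I_n.+1).

(** Conjugation by the k-th power of the cyclic shift; indices add modulo n + 1. *)
Definition cshift k P : 'M[R]_n.+1 := \matrix_(i, j) P (i + k) (j + k).

Definition circ P d : R := \sum_i P i (i + d).

Lemma cshiftD k l P : cshift k (cshift l P) = cshift (k + l) P.
Proof. by apply/matrixP => i j; rewrite !mxE !addrA. Qed.

Lemma cshift0 P : cshift 0 P = P.
Proof. by apply/matrixP => i j; rewrite !mxE !addr0. Qed.

Lemma cshift_tr k P : (cshift k P)^T = cshift k P^T.
Proof. by apply/matrixP => i j; rewrite !mxE. Qed.

Lemma cshiftM k P Q : cshift k P *m cshift k Q = cshift k (P *m Q).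
Proof.
apply/matrixP => i j; rewrite !mxE [RHS](reindex_inj (addIr k))/=.
by apply: eq_bigr => l _; rewrite !mxE.
Qed.

Lemma mxtrace_cshift k P : \tr (cshift k P) = \tr P.
Proof.
rewrite /mxtrace [RHS](reindex_inj (addIr k))/=.
by apply: eq_bigr => l _; rewrite !mxE.
Qed.

Lemma mxtrace_cshift2 k l P Q :
  \tr (cshift k P *m cshift l Q) = \tr (P *m cshift (l - k) Q).
Proof. by rewrite -(mxtrace_cshift k (P *m _)) -cshiftM cshiftD subrKC. Qed.

Lemma mxtrace_cshiftC k P Q : \tr (P *m cshift k Q) = \tr (Q *m cshift (- k) P).
Proof. by rewrite mxtrace_mulC -{1}(cshift0 P) mxtrace_cshift2 sub0r. Qed.

(** For each entry P i (i + d), summing over all shifts runs once through the cyclic diagonal of Q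
    of offset -d. *)
Lemma sum_mxtrace_cshift P Q :
  \sum_k \tr (P *m cshift k Q) = \sum_d circ P d * circ Q (- d).
Proof.
rewrite exchange_big/=.
under eq_bigr => i _ do under eq_bigr => k _ do rewrite mxE.
under eq_bigr => i _ do rewrite exchange_big/=.
under eq_bigr => i _ do rewrite (reindex_inj (addrI i))/=.
rewrite exchange_big/=; apply: eq_bigr => d _.
rewrite mulr_suml; apply: eq_bigr => i _.
rewrite -mulr_sumr; congr (_ * _).
rewrite /circ [RHS](reindex_inj (addrI (i + d)))/=.
by apply: eq_bigr => k _; rewrite mxE addrAC addrK.
Qed.

Lemma circ_opp P d : P^T = P -> circ P (- d) = circ P d.
Proof.
move=> PT; rewrite /circ (reindex_inj (addIr d))/=.
by apply: eq_bigr => i _; rewrite addrK -{1}PT mxE.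
Qed.

Lemma circ0 P : circ P 0 = \tr P.
Proof. by apply: eq_bigr => i _; rewrite addr0. Qed.

End CyclicShift.

Lemma shift_mxE (R : realType) n (i j : 'I_n.+2) :
  shift_mx R n.+2 i j = (j == i + 1)%:R.
Proof. by rewrite mxE -val_eqE /= [(1 %% _)%N]modn_small// addn1. Qed.

Lemma shift_actE (R : realType) n (P : 'M[R]_n.+2) : shift_act P = cshift 1 P.
Proof.
have sum_shift (f : 'I_n.+2 -> R) i : \sum_l shift_mx R n.+2 i l * f l = f (i + 1).
  rewrite (bigD1 (i + 1))//= shift_mxE eqxx mul1r big1 ?addr0// => l li.
  by rewrite shift_mxE (negbTE li) mul0r.
apply/matrixP => i j; rewrite !mxE.
under eq_bigr => l _ do rewrite mulrC [_^T l j]mxE.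
by rewrite sum_shift mxE sum_shift.
Qed.

(** * Projections onto planes of R^5, and the shift-invariant plane *)

Section Planes.
Variable R : realType.
Implicit Types (u v : 'rV[R]_5) (z : R).

Definition plane u v : 'M[R]_5 := u^T *m u + v^T *m v.

Lemma plane_sym u v : (plane u v)^T = plane u v.
Proof. by rewrite linearD /= !trmx_mul !trmxK. Qed.

Section Orthonormal.
Variables u v : 'rV[R]_5.
Hypotheses (uu : u *m u^T = 1%:M) (uv : u *m v^T = 0) (vv : v *m v^T = 1%:M).

Lemma plane_idem : plane u v *m plane u v = plane u v.
Proof.
have vu : v *m u^T = 0 by rewrite -[v]trmxK -trmx_mul uv trmx0.
rewrite mulmxDl !mulmxDr !mulmxA -!(mulmxA _ u) -!(mulmxA _ v).
by rewrite uu uv vu vv !mulmx0 !mul0mx !mulmx1 addr0 add0r.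
Qed.

Lemma plane_trace : \tr (plane u v) = 2.
Proof.
by rewrite linearD /= !(mxtrace_mulC _^T) uu vv mxtrace1.
Qed.

End Orthonormal.

(* The cshift-invariant plane of frequency 1 has as entries
   (2/5) cos (2 pi (j - i) / 5), and cos (2 pi / 5) = (z - 1) / 4. *)
Definition freq (z : R) (d : 'I_5) : R :=
  [:: 2 / 5; (z - 1) / 10; - (z + 1) / 10; - (z + 1) / 10; (z - 1) / 10]`_d.

Definition freq_plane z : 'M[R]_5 := \matrix_(i, j) freq z (j - i).

Lemma ord5P (P : 'I_5 -> Prop) : P 0 -> P 1 -> P 2 -> P (- 2) -> P (- 1) -> forall i, P i.
Proof.
move=> P0 P1 P2 P3 P4 [[|[|[|[|[|]]]]] i5]//.
- by rewrite (_ : Ordinal i5 = 0)//; apply: val_inj.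
- by rewrite (_ : Ordinal i5 = 1)//; apply: val_inj.
- by rewrite (_ : Ordinal i5 = 2)//; apply: val_inj.
- by rewrite (_ : Ordinal i5 = - 2)//; apply: val_inj.
- by rewrite (_ : Ordinal i5 = - 1)//; apply: val_inj.
Qed.

Lemma sum5E (f : 'I_5 -> R) : \sum_i f i = f 0 + f 1 + f 2 + f (- 2) + f (- 1).
Proof.
rewrite !big_ord_recl big_ord0 !addrA addr0.
by congr (f _ + f _ + f _ + f _ + f _); apply: val_inj.
Qed.

Lemma freqN z d : freq z (- d) = freq z d.
Proof. by elim/ord5P: d. Qed.

Lemma freq_plane_sym z : (freq_plane z)^T = freq_plane z.
Proof. by apply/matrixP => i j; rewrite !mxE -freqN opprB. Qed.

(** A circulant matrix is idempotent when its first row is idempotent under convolution; here each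
    entry is an identity modulo z^2 = 5. *)
Lemma freq_conv z d : z * z = 5 -> \sum_m freq z m * freq z (d - m) = freq z d.
Proof.
move=> zz; elim/ord5P: d; rewrite sum5E /freq /=; nra.
Qed.

Lemma freq_plane_idem z : z * z = 5 -> freq_plane z *m freq_plane z = freq_plane z.
Proof.
move=> zz; apply/matrixP => i j; rewrite !mxE -freq_conv//.
rewrite (reindex_inj (addrI i))/=; apply: eq_bigr => m _.
by rewrite !mxE addrC addKr opprD addrA.
Qed.

Lemma cshift_freq_plane z k : cshift k (freq_plane z) = freq_plane z.
Proof. by apply/matrixP => i j; rewrite !mxE opprD addrACA subrr addr0. Qed.

Lemma freq_plane_trace z : \tr (freq_plane z) = 2.
Proof.
rewrite /mxtrace; under eq_bigr do rewrite mxE subrr.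
by rewrite sumr_const card_ord /freq /=; lra.
Qed.

End Planes.

Lemma circ_freq_plane (R : realType) (z : R) d : circ (freq_plane z) d = 5 * freq z d.
Proof.
rewrite /circ; under eq_bigr do rewrite mxE addrAC subrr add0r.
by rewrite sumr_const card_ord mulr_natl.
Qed.

Lemma is_grass_point_idem (R : realType) n m (P : 'M[R]_n) :
  P^T = P -> P *m P = P -> \tr P = m%:R -> is_grass_point m P.
Proof.
move=> PT PP trP; split=> //; split=> //.
by apply/eqP; rewrite -(eqr_nat R) mxrank_idempotent// trP.
Qed.

(** * All traces from the prescribed ones *)

Section Simplex.
Variables (R : realType) (A B : 'M[R]_5) (z : R).
Hypotheses (AT : A^T = A) (AA : A *m A = A) (trA : \tr A = 2).
Hypotheses (BT : B^T = B) (BB : B *m B = B) (trB : \tr B = 2).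
Hypothesis zz : z * z = 5.
(** [circ1] and [circ2] say that the 11 projections sum to 22/5 times the identity: off the
    diagonal, the entries of [freq_plane z] cancel the circulant sums. *)
Hypothesis circ1 : circ A 1 + circ B 1 = (1 - z) / 10.
Hypothesis circ2 : circ A 2 + circ B 2 = (1 + z) / 10.
(** By [tr_freq], this amounts to tr(A F) = 17/25. *)
Hypothesis circA : (z - 1) * circ A 1 - (z + 1) * circ A 2 = - (3 / 5).
Hypothesis AA1 : \tr (A *m cshift 1 A) = 17 / 25.
Hypothesis AA2 : \tr (A *m cshift 2 A) = 17 / 25.
Hypothesis BB1 : \tr (B *m cshift 1 B) = 17 / 25.
Hypothesis AB : forall k : 'I_5, k != - 1 -> \tr (A *m cshift k B) = 17 / 25.

(** Offset 0 contributes tr P tr Q = 4, and offsets d and -d contribute equally by symmetry. *)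
Let sum_tr (P Q : 'M[R]_5) : P^T = P -> Q^T = Q -> \tr P = 2 -> \tr Q = 2 ->
  \sum_k \tr (P *m cshift k Q) = 4 + 2 * (circ P 1 * circ Q 1 + circ P 2 * circ Q 2).
Proof.
move=> PT QT trP trQ; rewrite sum_mxtrace_cshift sum5E !opprK oppr0.
by rewrite !circ_opp// !circ0 trP trQ; ring.
Qed.

Let circ_sqr : circ A 1 ^+ 2 + circ A 2 ^+ 2 = 9 / 25.
Proof.
have := sum_tr AT AT trA trA; rewrite sum5E cshift0 AA trA AA1 AA2.
rewrite (mxtrace_cshiftC (- 2)) (mxtrace_cshiftC (- 1)) !opprK AA1 AA2 !expr2; lra.
Qed.

Let circB1 : circ B 1 = (1 - z) / 10 - circ A 1. Proof. by rewrite -circ1 addrC addKr. Qed.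
Let circB2 : circ B 2 = (1 + z) / 10 - circ A 2. Proof. by rewrite -circ2 addrC addKr. Qed.

Let trAB k : \tr (A *m cshift k B) = 17 / 25.
Proof.
have [->|] := eqVneq k (- 1); last exact: AB.
(* By [circ_sqr] and [circA] the five products add up to 17/5, which leaves 17/25 for the missing
   one. *)
have := sum_tr AT BT trA trB; rewrite sum5E (@AB 0)// (@AB 1)//.
rewrite (@AB 2)// (@AB (- 2))// circB1 circB2.
by move: circ_sqr circA; set t := \tr _; rewrite !expr2; lra.
Qed.

Let trAA k : k != 0 -> \tr (A *m cshift k A) = 17 / 25.
Proof.
by elim/ord5P: k; rewrite ?eqxx// => _; rewrite ?AA1 ?AA2// mxtrace_cshiftC opprK.
Qed.

Let trBB k : k != 0 -> \tr (B *m cshift k B) = 17 / 25.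
Proof.
(* Since z^2 = 5, the squares of [circ B 1] and [circ B 2] also add up to 9/25, which fixes the last
   product. *)
have BB2 : \tr (B *m cshift 2 B) = 17 / 25.
  have := sum_tr BT BT trB trB; rewrite sum5E cshift0 BB trB BB1.
  rewrite (mxtrace_cshiftC (- 2)) (mxtrace_cshiftC (- 1)) !opprK BB1 circB1 circB2.
  by move: circ_sqr circA zz; rewrite !expr2; lra.
by elim/ord5P: k; rewrite ?eqxx// => _; rewrite ?BB1 ?BB2// mxtrace_cshiftC opprK.
Qed.

(** The invariant plane is fixed by all shifts, so the sum over shifts is five times one trace. *)
Let tr_freq (P : 'M[R]_5) : P^T = P -> \tr P = 2 ->
  \tr (P *m freq_plane z) = 4 / 5 + ((z - 1) * circ P 1 - (z + 1) * circ P 2) / 5.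
Proof.
move=> PT trP.
have := sum_tr PT (freq_plane_sym z) trP (freq_plane_trace z).
under eq_bigr do rewrite cshift_freq_plane.
by rewrite sumr_const card_ord !circ_freq_plane /freq /= -mulr_natl; lra.
Qed.

Let trAF : \tr (A *m freq_plane z) = 17 / 25.
Proof. by rewrite tr_freq// circA; lra. Qed.

Let trBF : \tr (B *m freq_plane z) = 17 / 25.
Proof. by rewrite tr_freq// circB1 circB2; move: circA zz; lra. Qed.

Definition simplex_point (p : option (bool * 'I_5)) : 'M[R]_5 :=
  match p with
  | Some (false, k) => cshift k A
  | Some (true, k) => cshift k B
  | None => freq_plane z
  end.

Lemma simplex_point_grass p : is_grass_point 2 (simplex_point p).
Proof.
apply: is_grass_point_idem; case: p => [[[] k]|] /=.
- by rewrite cshift_tr BT.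
- by rewrite cshift_tr AT.
- exact: freq_plane_sym.
- by rewrite cshiftM BB.
- by rewrite cshiftM AA.
- exact: freq_plane_idem.
- by rewrite mxtrace_cshift.
- by rewrite mxtrace_cshift.
- exact: freq_plane_trace.
Qed.

Lemma simplex_point_trace p q : p != q ->
  \tr (simplex_point p *m simplex_point q) = 17 / 25.
Proof.
have subk (k l : 'I_5) b : Some (b, k) != Some (b, l) -> l - k != 0.
  by rewrite subr_eq0; apply: contraNneq => ->.
case: p q => [[[] k]|] [[[] l]|] //= pq.
- by rewrite mxtrace_cshift2 trBB// (subk _ _ _ true).
- by rewrite mxtrace_mulC mxtrace_cshift2.
- by rewrite -(cshift_freq_plane z k) mxtrace_cshift2 cshift_freq_plane.
- by rewrite mxtrace_cshift2.
- by rewrite mxtrace_cshift2 trAA// (subk _ _ _ false).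
- by rewrite -(cshift_freq_plane z k) mxtrace_cshift2 cshift_freq_plane.
- by rewrite mxtrace_mulC -(cshift_freq_plane z l) mxtrace_cshift2 cshift_freq_plane.
- by rewrite mxtrace_mulC -(cshift_freq_plane z l) mxtrace_cshift2 cshift_freq_plane.
Qed.

(** Equal points of distinct indices would give tr(P P) = 17/25, whereas it is the rank 2. *)
Lemma simplex_point_inj : injective simplex_point.
Proof.
move=> p q pq; apply/eqP; apply: contraT => /simplex_point_trace.
have [_ [qq rq]] := simplex_point_grass q.
by rewrite pq qq -(mxrank_idempotent qq) rq; lra.
Qed.

Definition next_point (p : option (bool * 'I_5)) :=
  if p is Some (b, k) then Some (b, 1 + k) else None.

Lemma shift_act_simplex_point p :
  shift_act (simplex_point p) = simplex_point (next_point p).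
Proof.
rewrite shift_actE; case: p => [[[] k]|] /=; rewrite ?cshiftD//.
exact: cshift_freq_plane.
Qed.

Lemma cyclic_tight_simplex : exists Pi : 'I_11 -> 'M[R]_5,
  @tight_simplex R 2 5 11 Pi /\
  (forall i : 'I_11, exists j : 'I_11, shift_act (Pi i) = Pi j).
Proof.
have card_idx : 11%N = #|{: option (bool * 'I_5)}|.
  by rewrite card_option card_prod card_bool card_ord.
pose idx (i : 'I_11) := enum_val (cast_ord card_idx i).
have idx_inj : injective idx by move=> i j /enum_val_inj /cast_ord_inj.
exists (simplex_point \o idx); split; last first.
  move=> i; exists (cast_ord (esym card_idx) (enum_rank (next_point (idx i)))).
  by rewrite /= shift_act_simplex_point {2}/idx cast_ordKV enum_rankK.
split; first exact: inj_comp simplex_point_inj idx_inj.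
split=> [i|i j ij]; first exact: simplex_point_grass.
rewrite simplex_point_trace ?(inj_eq idx_inj)//.
(* The tight value is 2 (11 * 2 - 5) / 50 = 17/25. *)
have -> : 5 * (11 - 1) = 50 :> R by ring.
by lra.
Qed.

End Simplex.

(** * The equations and an approximate solution *)

(* The 17 unknowns are the coordinates multiplied by [scale]; the equations
   are homogenized accordingly, so that all the data are integers. *)
Definition scale : Z := 1000000%Z.

Definition psum5 (f : nat -> pexp) : pexp :=
  Add (f 0) (Add (f 1) (Add (f 2) (Add (f 3) (f 4)))).

Definition psub (p q : pexp) : pexp := Add p (Mul (Cst (-1)%Z) q).

Definition pcoord (l : seq pexp) (i : nat) : pexp := nth (Cst 0) l i.

Definition pinner (a b : nat -> pexp) : pexp := psum5 (fun i => Mul (a i) (b i)).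

Definition pplane (a b : nat -> pexp) (i j : nat) : pexp :=
  Add (Mul (a i) (a j)) (Mul (b i) (b j)).

Definition pcirc (P : nat -> nat -> pexp) (d : nat) : pexp :=
  psum5 (fun i => P i ((i + d) %% 5)%N).

Definition ptrace (P Q : nat -> nat -> pexp) (k : nat) : pexp :=
  psum5 (fun i => psum5 (fun j => Mul (P i j) (Q ((j + k) %% 5)%N ((i + k) %% 5)%N))).

(** [pu], [pv] span A and [ps], [pt] span B; the entries [Cst 0] are the four normalized
    coordinates. *)
Definition pu := pcoord [:: Var 0; Var 1; Var 2; Var 3; Var 4].
Definition pv := pcoord [:: Cst 0; Cst 0; Var 5; Var 6; Var 7].
Definition ps := pcoord [:: Var 8; Var 9; Var 10; Var 11; Var 12].
Definition pt := pcoord [:: Cst 0; Var 13; Cst 0; Var 14; Var 15].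
Definition pz := Var 16.
Definition pA := pplane pu pv.
Definition pB := pplane ps pt.

(** Up to homogenizing powers of N and cleared denominators, every paired integer is the same slope
    100 / N. *)
Definition simplex_equations : seq (Z * pexp) :=
  let N := scale in
  let D := 100%Z * N in
  let inner a b z := (D, psub (pinner a b) (Cst z)) in
  let trace P Q k := (25%Z * D * (N * N),
    psub (Mul (Cst 25%Z) (ptrace P Q k)) (Cst (17%Z * (N * N * (N * N))))) in
  [:: inner pu pu (N * N); inner pu pv 0; inner pv pv (N * N);
      inner ps ps (N * N); inner ps pt 0; inner pt pt (N * N);
      (D, psub (Mul pz pz) (Cst (5%Z * (N * N))));
      (10%Z * D, psub (Mul (Cst 10%Z) (Add (pcirc pA 1) (pcirc pB 1)))
                      (Mul (Cst N) (psub (Cst N) pz)));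
      (10%Z * D, psub (Mul (Cst 10%Z) (Add (pcirc pA 2) (pcirc pB 2)))
                      (Mul (Cst N) (Add (Cst N) pz)));
      (5%Z * D * N,
        Add (Mul (Cst 5%Z) (psub (Mul (psub pz (Cst N)) (pcirc pA 1))
                                 (Mul (Add pz (Cst N)) (pcirc pA 2))))
            (Cst (3%Z * N * (N * N))));
      trace pA pA 1%N; trace pA pA 2%N; trace pB pB 1%N;
      trace pA pB 0%N; trace pA pB 1%N; trace pA pB 2%N; trace pA pB 3%N].

(* The gradients form the inverse Jacobian matrix of the equations at the
   center, up to rounding and the integers paired with the equations. *)
Definition newton_chart : seq affine :=
  [:: (-711109, [:: -24; 22; 40; 26; 12; 11; -1; 15; -13; -1; 22; -38; 2; -15; -29; 11; -16]);
      (-654742, [:: -3; -27; 11; 1; -4; -2; 0; 3; 4; -8; -52; 16; 1; -3; 9; -3; 0]);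
      (-46998, [:: 15; 81; 24; 18; -14; -6; 0; 21; 13; 1; -15; -20; 7; -23; 29; -11; -7]);
      (-143677, [:: -97; 18; -112; -73; 5; -9; 1; -60; 0; 23; 60; 71; -15; 63; -4; 1; 38]);
      (206845, [:: 84; 19; 98; 46; 28; 24; -1; 22; -31; -12; -51; -35; 3; -21; -66; 25; -29]);
      (947068, [:: 36; -38; 86; 10; -10; -4; 0; 13; 9; 0; -26; -33; 4; -14; 20; -7; -4]);
      (119289, [:: 12; 48; 57; 68; 10; 17; -1; 48; -14; -1; -17; 9; 11; -49; -28; 11; -37]);
      (298048, [:: -119; 101; -129; -59; 26; 6; 1; -59; -21; -1; 90; 100; -17; 64; -51; 19; 27]);
      (-527636, [:: -90; 64; -88; -41; 37; -37; 0; -51; -63; -11; 58; 89; 0; 60; -17; 31; -48]);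
      (240596, [:: -77; 11; -76; 11; -60; -6; 1; -77; -30; 6; 71; 77; -32; 11; -3; 5; -9]);
      (-763455, [:: 47; -17; 39; -19; -15; 41; 0; -3; 26; 7; -13; -21; -14; -36; -10; -34; 18]);
      (281838, [:: 30; 53; 12; 33; 76; 40; 0; -29; -21; -6; 7; 33; 1; 1; -51; -40; -26]);
      (-37661, [:: 43; -82; 54; -48; -28; -51; -1; 73; 7; -4; -45; -84; 75; -44; 46; 4; 52]);
      (-762645, [:: -123; -63; -100; -35; 5; -101; 1; -53; -12; 15; 75; 45; -25; 3; 63; 51; 29]);
      (633777, [:: -151; -67; -125; -28; -2; -45; 0; -64; -33; 13; 94; 62; -36; 7; 70; 61; 30]);
      (-129225, [:: -14; 38; -21; 69; -36; -11; -1; -1; -92; -26; 20; 38; -32; 17; -24; -7; -23]);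
      (2236068, [:: 0; 0; 0; 0; 0; 0; 22; 0; 0; 0; 0; 0; 0; 0; 0; 0; 0])]%Z.

(** On the cube of radius 1 each unscaled unknown moves by less than 1/1000, which keeps the
    quadratic errors small. *)
Lemma newton_chart_check : newton_check 1 newton_chart simplex_equations.
Proof. by vm_compute. Qed.

(** * From the integer equations to traces of real matrices *)

Section Evaluation.
Variables (R : realType) (x : nat -> R).
Implicit Types (a b : nat -> pexp) (p q : pexp) (k : 'I_5).

Let c : R := Zr R scale.

Let c_neq0 : c != 0.
Proof. by rewrite gt_eqF// -(Zr0 R) Zr_lt. Qed.

Lemma peval_Cst w : peval x (Cst w) = Zr R w. Proof. by []. Qed.

Lemma peval_Add p q : peval x (Add p q) = peval x p + peval x q.
Proof. by []. Qed.

Lemma peval_Mul p q : peval x (Mul p q) = peval x p * peval x q.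
Proof. by []. Qed.

Lemma peval_psub p q : peval x (psub p q) = peval x p - peval x q.
Proof. by rewrite /= [Zr R _]mulrN1z mulN1r. Qed.

Lemma peval_psum5 (f : nat -> pexp) : peval x (psum5 f) = \sum_(i < 5) peval x (f i).
Proof. by rewrite !big_ord_recl big_ord0 addr0. Qed.

Definition evec a : 'rV[R]_5 := \row_i (peval x (a i) / c).

Let evalE a (i : 'I_5) : peval x (a i) = c * evec a 0 i.
Proof. by rewrite mxE mulrC divfK. Qed.

Let eplane a b := plane (evec a) (evec b).

Lemma peval_pinner a b : peval x (pinner a b) = c * c * (evec a *m (evec b)^T) 0 0.
Proof.
rewrite peval_psum5 mxE mulr_sumr; apply: eq_bigr => i _ /=.
by rewrite !evalE [_^T _ _]mxE; ring.
Qed.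

Lemma peval_pplane a b (i j : 'I_5) : peval x (pplane a b i j) = c * c * eplane a b i j.
Proof.
by rewrite /= !evalE /eplane /plane mxE !mxE !big_ord1 !mxE; ring.
Qed.

Lemma peval_pcirc a b k : peval x (pcirc (pplane a b) k) = c * c * circ (eplane a b) k.
Proof.
rewrite peval_psum5 mulr_sumr; apply: eq_bigr => i _.
(* The index [(i + d) %% 5] is convertible to the sum in ['I_5]. *)
exact: (peval_pplane a b i (i + k)).
Qed.

Lemma peval_ptrace a b a' b' k : peval x (ptrace (pplane a b) (pplane a' b') k) =
  c * c * (c * c) * \tr (eplane a b *m cshift k (eplane a' b')).
Proof.
rewrite peval_psum5 mulr_sumr; apply: eq_bigr => i _.
rewrite peval_psum5 mxE mulr_sumr; apply: eq_bigr => j _.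
transitivity (peval x (pplane a b i j) * peval x (pplane a' b' (j + k)%R (i + k)%R)).
  by [].
by rewrite !peval_pplane [cshift _ _ _ _]mxE; ring.
Qed.

End Evaluation.

Theorem theorem6p6 (R : realType) :
  exists Pi : 'I_11 -> 'M[R]_5,
    @tight_simplex R 2 5 11 Pi /\
    (forall i : 'I_11, exists j : 'I_11, shift_act (Pi i) = Pi j).
Proof.
have [x xP] := newton_root R newton_chart_check.
(* [c] stays opaque, so that [lra] treats it as an atom and not as a large numeral. *)
have [c cE] : {c : R | c = Zr R scale} by exists (Zr R scale).
have c0 : c != 0 by rewrite cE gt_eqF// -(Zr0 R) Zr_lt.
pose z := x 16%N / c.
have zE : peval x pz = c * z by rewrite /z mulrC divfK.
have circE a b (k : 'I_5) : peval x (pcirc (pplane a b) k) =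
    c * c * circ (plane (evec x a) (evec x b)) k by rewrite peval_pcirc -cE.
have circ1 a b : peval x (pcirc (pplane a b) 1) =
  c * c * circ (plane (evec x a) (evec x b)) 1 := circE a b 1.
have circ2 a b : peval x (pcirc (pplane a b) 2) =
  c * c * circ (plane (evec x a) (evec x b)) 2 := circE a b 2.
have inner_eq a b w : peval x (psub (pinner a b) (Cst w)) = 0 ->
    c * c * (evec x a *m (evec x b)^T) 0 0 = Zr R w.
  by rewrite peval_psub peval_pinner -cE => /subr0_eq.
have one_eq a b : peval x (psub (pinner a b) (Cst (scale * scale))) = 0 ->
    evec x a *m (evec x b)^T = 1%:M.
  move=> /inner_eq; rewrite ZrM -cE -[RHS]mulr1 => /(mulfI (mulf_neq0 c0 c0)) E.
  by apply/matrixP => i j; rewrite !ord1 E mxE.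
have zero_eq a b : peval x (psub (pinner a b) (Cst 0)) = 0 ->
    evec x a *m (evec x b)^T = 0.
  move=> /inner_eq; rewrite Zr0 => /eqP; rewrite !mulf_eq0 (negbTE c0)/= => /eqP E.
  by apply/matrixP => i j; rewrite !ord1 E mxE.
have trace_eq a b a' b' (k : 'I_5) :
    peval x (psub (Mul (Cst 25%Z) (ptrace (pplane a b) (pplane a' b') k))
      (Cst (17%Z * (scale * scale * (scale * scale))))) = 0 ->
    \tr (plane (evec x a) (evec x b) *m cshift k (plane (evec x a') (evec x b'))) = 17 / 25.
  rewrite peval_psub peval_Mul peval_ptrace !peval_Cst.
  rewrite !ZrM -cE (_ : Zr R 25%Z = 25)// (_ : Zr R 17%Z = 17)//.
  rewrite mulrCA [17 * _]mulrC -mulrBr => /eqP.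
  rewrite !mulf_eq0 (negbTE c0)/= subr_eq0 => /eqP E.
  by rewrite -E mulrC mulKf.
have E k (k17 : (k < 17)%N) := xP k k17.
have uu := one_eq _ _ (E 0 isT); have uv := zero_eq _ _ (E 1%N isT).
have vv := one_eq _ _ (E 2 isT); have ss := one_eq _ _ (E 3 isT).
have st := zero_eq _ _ (E 4 isT); have tt := one_eq _ _ (E 5 isT).
apply: (@cyclic_tight_simplex R (plane (evec x pu) (evec x pv))
  (plane (evec x ps) (evec x pt)) z) => //.
- exact: plane_sym.
- exact: plane_idem.
- exact: plane_trace.
- exact: plane_sym.
- exact: plane_idem.
- exact: plane_trace.
- have := E 6 isT; rewrite peval_psub peval_Mul peval_Cst zE !ZrM -cE.
  rewrite (_ : Zr R 5%Z = 5)// => /subr0_eq zz; apply: (mulfI (mulf_neq0 c0 c0)).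
  lra.
- have := E 7 isT; rewrite peval_psub !peval_Mul peval_Add !circ1.
  rewrite !peval_psub !peval_Cst zE -cE (_ : Zr R 10%Z = 10)// => e.
  apply: (mulfI (mulf_neq0 c0 c0)); lra.
- have := E 8 isT; rewrite peval_psub !peval_Mul peval_Add !circ2.
  rewrite peval_Add !peval_Cst zE -cE (_ : Zr R 10%Z = 10)// => e.
  apply: (mulfI (mulf_neq0 c0 c0)); lra.
- have := E 9 isT; rewrite peval_Add peval_Mul peval_psub !peval_Mul circ1 circ2.
  rewrite peval_psub peval_Add !peval_Cst zE !ZrM -cE.
  rewrite (_ : Zr R 5%Z = 5)// (_ : Zr R 3%Z = 3)// => e.
  apply: (mulfI (mulf_neq0 c0 (mulf_neq0 c0 c0))); lra.
- exact: trace_eq 1 (E 10 isT).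
- exact: trace_eq 2 (E 11 isT).
- exact: trace_eq 1 (E 12 isT).
(* The case -1 contradicts its hypothesis; -2 is the shift by 3 of the last equation. *)
- elim/ord5P => // _.
  + exact: trace_eq 0 (E 13 isT).
  + exact: trace_eq 1 (E 14 isT).
  + exact: trace_eq 2 (E 15 isT).
  + exact: trace_eq (- 2) (E 16 isT).
Qed.
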